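(* Let $s\in(0,1)$ and let $\{X_n\}_{n\in\mathbb{N}}$ be a Manneville-Pomeau process with parameter $s$, $X_n=\varphi(T_s^n(U_0))$, with $\varphi\in\mathcal{L}^1(\mu_s)$ an almost everywhere decreasing function. Let $t,h_1,\dots,h_n\in\mathbb{N}$ with $n\geq 1$ and $0<h_1<\cdots<h_n$, and set $Y_0:=U_0$ and $Y_k:=T_s^{h_k}(U_0)$ for $k=1,\dots,n$. Denote by $C_{\boldsymbol t}$ the copula of the random vector $(X_t,X_{t+h_1},\dots,X_{t+h_n})$. Then $$C_{\boldsymbol t}(u_0,\dots,u_n)=-n+\sum_{i=0}^n u_i+\sum_{r=2}^{n+1}(-1)^r\sum_{0\le k_1<\cdots<k_r\le n}C_{Y_{k_1},\dots,Y_{k_r}}(1-u_{k_1},\dots,1-u_{k_r})$$ for all $(u_0,\dots,u_n)\in I^{n+1}$.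
   Context: $I=[0,1]$, $\mathbb{N}=\{0,1,2,\dots\}$, $\lambda$ is Lebesgue measure on $I$. For $s>0$ the Manneville-Pomeau transformation $T_s:I\to I$ is $T_s(x)=x+x^{1+s}\ (\mathrm{mod}\ 1)$, i.e. $T_s(x)=x+x^{1+s}$ if $x+x^{1+s}<1$ and $T_s(x)=x+x^{1+s}-1$ otherwise; $T_s^k$ is its $k$-fold composition. For $s\in(0,1)$, $\mu_s$ denotes the $T_s$-invariant Borel probability measure on $I$ that is absolutely continuous with respect to $\lambda$; it is ergodic and has a positive density, so $F_0(x):=\mu_s([0,x])$ is a continuous, strictly increasing bijection of $I$. $U_0$ is a random variable with law $\mu_s$, and for $\varphi:I\to\mathbb{R}$ in $\mathcal{L}^1(\mu_s)$ the process $X_t=\varphi(T_s^t(U_0))$, $t\in\mathbb{N}$, is a Manneville-Pomeau (MP) process with parameter $s$. ''Almost everywhere decreasing'' means strictly decreasing on $I\setminus N$ for some $\lambda$-null set $N$. $C_{Z_1,\dots,Z_r}$ denotes the copula of the random vector $(Z_1,\dots,Z_r)$ with continuous marginals. *)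

(* Defs.v *)
From HB Require Import structures.
From mathcomp Require Import all_boot all_order all_algebra.
From mathcomp Require Import all_classical all_reals all_analysis.

Set Implicit Arguments.
Unset Strict Implicit.
Unset Printing Implicit Defensive.

Import Order.TTheory GRing.Theory Num.Theory.
Import numFieldNormedType.Exports.

Local Open Scope classical_set_scope.
Local Open Scope ring_scope.

(* Maps on I = [0,1] are represented by functions R -> R of which only the
   values on I matter: [MP_map s] sends I to I when 0 < s, and the base
   variable U0 below takes its values in I. *)
Definition MP_map (R : realType) (s : R) (x : R) : R :=
  let y := x + x `^ (1 + s) in if y < 1 then y else y - 1.

(* For 0 < s < 1 there is exactly one such mu (a classical fact, not assumed
   anywhere below). *)
Definition is_MP_measure (R : realType) (s : R)
    (mu : probability (measurableTypeR R) R) : Prop :=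
  [/\ mu `[0, 1]%classic = 1%E,
      forall A : set R, measurable A -> A `<=` `[0, 1]%classic ->
        mu (`[0, 1]%classic `&` MP_map s @^-1` A) = mu A
    & mu `<< @lebesgue_measure R].

Definition ae_decreasing (R : realType) (phi : R -> R) : Prop :=
  exists2 N : set R, (@lebesgue_measure R).-negligible N &
    {in `[0, 1]%classic `\` N &, forall x y, x < y -> phi y < phi x}.

Definition is_MP_process (R : realType) (s : R)
    (mu : probability (measurableTypeR R) R)
    (d : measure_display) (Omega : measurableType d) (P : probability Omega R)
    (U0 : {RV P >-> R}) (phi : R -> R) (X : nat -> {RV P >-> R}) : Prop :=
  [/\ is_MP_measure s mu,
      forall w, U0 w \in `[0, 1],
      forall A : set R, measurable A -> distribution P U0 A = mu A,
      mu.-integrable `[0, 1]%classic (EFin \o phi)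
    & forall t w, X t w = phi (iter t (MP_map s) (U0 w))].

(* A p-dimensional copula is a distribution function on I^p with uniform
   one-dimensional marginals; Q is the associated law on R^p. *)
Definition is_copula (R : realType) (p : nat) (C : ('I_p -> R) -> R) : Prop :=
  exists Q : probability (p.-tuple (measurableTypeR R)) R,
    (forall (i : 'I_p) (A : set R), measurable A ->
       Q [set v | A (tnth v i)] = uniform_prob (@ltr01 R) A) /\
    (forall u : 'I_p -> R, (forall i, u i \in `[0, 1]) ->
       Q [set v | forall i, tnth v i <= u i] = (C u)%:E).

(* Sklar's relation between the joint distribution function of Z and its
   marginals. *)
Definition is_copula_of (R : realType)
    (d : measure_display) (Omega : measurableType d) (P : probability Omega R)
    (p : nat) (Z : 'I_p -> {RV P >-> R}) (C : ('I_p -> R) -> R) : Prop :=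
  is_copula C /\
  forall x : 'I_p -> R,
    P [set w | forall i, Z i w <= x i] =
    (C (fun i => fine (cdf (Z i) (x i))))%:E.

(* By Sklar's theorem, for continuous marginals such a C exists and its values
   on I^p are unique; its values outside I^p are irrelevant. *)
Definition copula_of (R : realType)
    (d : measure_display) (Omega : measurableType d) (P : probability Omega R)
    (p : nat) (Z : 'I_p -> {RV P >-> R}) : ('I_p -> R) -> R :=
  xget (fun=> 0) [set C | is_copula_of Z C].

(* The sequence 0, h_1, ..., h_n; the paper's h_i is [h] at the ordinal i-1. *)
Definition lag (n : nat) (h : 'I_n -> nat) (k : 'I_n.+1) : nat :=
  if unlift ord0 k is Some i then h i else 0%N.

Definition increasing_idx (r m : nat) (k : {ffun 'I_r -> 'I_m}) : bool :=
  [forall i : 'I_r, forall j : 'I_r, (i < j)%N ==> (k i < k j)%N].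

(* Main.v *)
Require Import Defs.
From HB Require Import structures.
From mathcomp Require Import all_boot all_order all_algebra.
From mathcomp Require Import all_classical all_reals all_analysis.
From mathcomp Require Import measurable_realfun lra ring.

Set Implicit Arguments.
Unset Strict Implicit.
Unset Printing Implicit Defensive.

Import Order.TTheory GRing.Theory Num.Theory.
Import numFieldNormedType.Exports.

Local Open Scope classical_set_scope.
Local Open Scope ring_scope.

(** A decreasing observable reverses ranks, and the survival function of a
    random vector is the inclusion-exclusion sum of its joint distribution
    functions.

    When every marginal distribution function F_i of Z is continuous, F_i(Z_i)
    is uniform on [0,1] ([cdf_transform_uniform]) and the copula of Z is the
    joint distribution function of the ranks F_i(Z_i) ([copula_ofE]).  Both
    sides of the formula therefore become probabilities of events about ranks.

    The invariant measure mu is absolutely continuous, so it has no atoms and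
    every T^j(U0) has law mu ([MP_process_stationary]).  Let F be the
    distribution function of mu and G that of phi(U0).  Off a null set phi
    strictly decreases, so phi(U0) <= phi(v) means U0 >= v, whence
    G(phi(v)) = 1 - F(v) ([cdf_decreasing_MP_process]).  The rank of
    X_(t+a_k) is thus 1 - F(T^(a_k)(T^t U0)); stationarity removes the shift
    by t, and since the ranks of the Y_k have no atoms the event that all
    ranks of the X_(t+a_k) are at most u_k has the probability of the event
    that no rank of Y_k is at most 1 - u_k ([rank_copula_decreasing]).

    Inclusion-exclusion ([inclusion_exclusion]) expands the latter probability
    over the sets J of indices, and sets of size r are the ranges of the
    increasing maps from r indices ([sum_sets_increasing]).  The empty set
    contributes 1, the singletons contribute - \sum_i (1 - u_i) by uniformity,
    and together these give - n + \sum_i u_i; the other terms are values of the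
    copulas of the subvectors of Y. *)

(** * Null events and equality of laws *)

Lemma measurable_forall (d : measure_display) (T : measurableType d)
    (I : finType) (A : I -> set T) :
  (forall i, measurable (A i)) -> measurable [set w | forall i, A i w].
Proof.
move=> mA; rewrite (_ : [set w | _] = \bigcap_(i in [set: I]) A i); last first.
  by apply/seteqP; split=> [w h i _|w h i]; apply: h.
by apply: fin_bigcap_measurable => //; exact: finite_finset.
Qed.

Lemma probability_eq_off_null (d : measure_display) (T : measurableType d)
    (R : realType) (P : probability T R) (A B N : set T) :
  measurable A -> measurable B -> measurable N -> P N = 0%E ->
  (forall w, ~ N w -> A w <-> B w) -> P A = P B.
Proof.
move=> mA mB mN N0 AB.
have PI C : measurable C -> P C = P (C `\` N).
  move=> mC; rewrite (measureDI P mC mN) [X in (_ + X)%E](_ : _ = 0%E) ?adde0//.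
  apply: (subset_measure0 _ mN _ N0); last exact: subIsetr.
  exact: measurableI.
rewrite PI// [RHS]PI//; congr (P _).
by apply/seteqP; split=> w [h nN]; split=> //; apply/(AB _ nN).
Qed.

(** The rays ]x, +oo[ form a pi-system that generates the Borel sets; they are
    complements of the rays measured by the distribution functions. *)
Lemma eq_law_of_eq_cdf (d d' : measure_display) (T : measurableType d)
    (T' : measurableType d') (R : realType) (P : probability T R)
    (Q : probability T' R) (f : {RV P >-> R}) (g : {RV Q >-> R}) :
  (forall c, cdf f c = cdf g c) ->
  forall A : set R, measurable A -> P (f @^-1` A) = Q (g @^-1` A).
Proof.
move=> fg A mA.
apply: (@measure_unique _ R R (@RGenOInfty.G R)
  (fun n => `](- (n%:R : R)), +oo[%classic) _ _ _ _
  (distribution P f) (distribution Q g)) => //.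
- exact: RGenOInfty.measurableE.
- move=> _ _ [x ->] [y ->]; exists (Num.max x y); apply/seteqP; split=> z /=.
    by rewrite !in_itv/= !andbT gt_max => -[-> ->].
  by rewrite !in_itv/= !andbT gt_max => /andP[].
- by move=> n; eexists; reflexivity.
- apply/seteqP; split=> // x _; exists (Num.bound `|x|) => //=.
  rewrite in_itv/= andbT ltrNl.
  by rewrite (le_lt_trans (ler_norm _))// normrN archi_boundP// normr_ge0.
- move=> _ [x ->]; have <- : ~` `]-oo, x]%classic = `]x, +oo[%classic.
    by rewrite setCitvl.
  have mI : measurable (`]-oo, x]%classic : set R) by exact: measurable_itv.
  apply: etrans (probability_setC (distribution P f) mI) _.
  apply: etrans _ (esym (probability_setC (distribution Q g) mI)).
  by congr (_ - _)%E; exact: fg.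
- by move=> k; apply: le_lt_trans (probability_le1 _ _) _; rewrite ?ltry.
Qed.

(** * Quantiles and uniformity of ranks *)

Lemma cdfE (d : measure_display) (T : measurableType d)
    (R : realType) (P : probability T R) (Z : {RV P >-> R}) (x : R) :
  cdf Z x = P [set w | Z w <= x].
Proof. by rewrite /cdf /distribution/= /pushforward/=; congr (P _). Qed.

Lemma fine_cdf_nondecreasing (d : measure_display) (T : measurableType d)
    (R : realType) (P : probability T R) (Z : {RV P >-> R}) (x y : R) :
  x <= y -> fine (cdf Z x) <= fine (cdf Z y).
Proof. by move=> xy; rewrite fine_le ?fin_num_measure// cdf_nondecreasing. Qed.

(** The witness is the largest c-quantile, the supremum x of the sublevel set
    {F <= c}.  Right continuity gives F x >= c; without atoms F x is also the
    limit of the values of F strictly below x, which gives F x <= c.  Choosing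
    the largest quantile makes F z <= c equivalent to z <= x, even where F is
    flat. *)
Lemma atomless_quantile (d : measure_display) (T : measurableType d)
    (R : realType) (P : probability T R) (Z : {RV P >-> R})
    (hZ : forall c, P (Z @^-1` [set c]) = 0%E) (c : R) : 0 < c -> c < 1 ->
  exists2 x, fine (cdf Z x) = c & forall z, (fine (cdf Z z) <= c) = (z <= x).
Proof.
move=> c0 c1; pose S : set R := [set z | fine (cdf Z z) <= c].
have cdfE z : (fine (cdf Z z))%:E = cdf Z z by rewrite fineK ?fin_num_measure.
have S0 : S !=set0.
  have /fine_cvg h := cvg_cdfNy0 Z.
  have /filter_ex[z hz] : \forall z \near -oo, fine (cdf Z z) < c.
    by apply: cvgr_lt c0; exact: h.
  by exists z; exact: ltW.
have [M hM] : exists M, c < fine (cdf Z M).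
  have /fine_cvg h := cvg_cdfy1 Z.
  have /filter_ex[z hz] : \forall z \near +oo, c < fine (cdf Z z).
    by apply: cvgr_gt c1; exact: h.
  by exists z.
have SM : ubound S M.
  move=> z /= zc; rewrite leNgt; apply/negP => /ltW/(fine_cdf_nondecreasing Z).
  by move=> /(lt_le_trans hM)/lt_le_trans/(_ zc); rewrite ltxx.
have supS : has_sup S by split => //; exists M.
have Slt z : z < sup S -> fine (cdf Z z) <= c.
  move=> /(sup_gt S0)[y Sy /ltW zy].
  exact: le_trans (fine_cdf_nondecreasing _ zy) Sy.
have Sgt z : sup S < z -> c < fine (cdf Z z).
  by move=> zS; rewrite ltNge; apply/negP => /(sup_upper_bound supS); rewrite leNgt zS.
set x := sup S in Slt Sgt *.
have Sx : fine (cdf Z x) <= c.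
  rewrite -lee_fin cdfE.
  (* P[Z <= x] equals P[Z < x], the limit of the P (A n). *)
  pose A n := Z @^-1` `]-oo, x - n.+1%:R^-1].
  have UA : \bigcup_n A n = Z @^-1` `]-oo, x[.
    apply/seteqP; split=> [w [n _]|w]; rewrite /A/= !in_itv/=.
      by move=> /le_lt_trans; apply; rewrite ltrBlDr ltrDl invr_gt0.
    move=> /ltr_add_invr[n hn]; exists n => //=; rewrite in_itv/=.
    by rewrite lerBrDr ltW.
  have mA n : measurable (A n) by exact: measurable_funPTI.
  have mUA : measurable (\bigcup_n A n) by exact: bigcup_measurable.
  have ndA : {homo A : n m / (n <= m)%N >-> (n <= m)%O}.
    move=> n m nm; apply/subsetPset => w; rewrite /A/= !in_itv/= => /le_trans; apply.
    by rewrite lerB// lef_pV2 ?posrE// ler_nat.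
  have hcvg := nondecreasing_cvg_mu (mu := P) mA mUA ndA.
  have -> : cdf Z x = P (\bigcup_n A n).
    rewrite UA /cdf /distribution /= /pushforward/=.
    apply: (probability_eq_off_null _ _ _ (hZ x)) => //.
    - exact: measurable_funPTI.
    - exact: measurable_funPTI.
    - move=> w /= Zx; rewrite !in_itv/= le_eqVlt.
      by split=> [/orP[/eqP//|//]|->]; rewrite ?orbT.
  apply: (cvge_le _ hcvg); apply: nearW => n /=.
  rewrite -[leLHS]cdfE lee_fin; apply: Slt.
  by rewrite ltrBlDr ltrDl invr_gt0.
exists x.
  apply/eqP; rewrite eq_le Sx/=.
  rewrite -lee_fin cdfE; apply: (cvge_ge _ (@cdf_right_continuous _ _ _ _ Z x)).
  have : \forall y \near x^'+, x < y by exact: nbhs_right_gt.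
  by apply: filterS => y xy; rewrite -cdfE lee_fin ltW// Sgt.
move=> z; apply/idP/idP => [|zx].
  by apply: contraTT; rewrite -!ltNge; exact: Sgt.
exact: le_trans (fine_cdf_nondecreasing Z zx) Sx.
Qed.

Lemma measurable_sublevel (d : measure_display) (T : measurableType d)
    (R : realType) (f : T -> R) (c : R) :
  measurable_fun [set: T] f -> measurable [set w | f w <= c].
Proof.
move=> mf; rewrite (_ : [set w | _] = [set: T] `&` f @^-1` `]-oo, c]); last first.
  by rewrite setTI; apply/seteqP; split=> w /=; rewrite in_itv.
exact: mf.
Qed.

Lemma uniform_prob01E (R : realType) (A : set R) : measurable A ->
  uniform_prob (@ltr01 R) A = lebesgue_measure (A `&` `[0, 1]).
Proof.
move=> mA; rewrite /uniform_prob integral_uniform_pdf.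
rewrite (eq_integral (fun=> 1%E)); last first.
  by move=> x; rewrite inE/= in_itv/= /uniform_pdf => -[_ ->]; rewrite subr0 invr1.
by rewrite integral_cst ?mul1e//; exact: measurableI.
Qed.

Lemma uniform_prob01_itv (R : realType) (a b : R) : 0 <= a -> a <= b -> b <= 1 ->
  uniform_prob (@ltr01 R) `]a, b]%classic = (b - a)%:E.
Proof.
move=> a0 ab b1; rewrite uniform_prob01E// setIidl.
  rewrite lebesgue_measure_itv/= lte_fin; case: ltP => [//|ba].
  by rewrite (@le_anti _ _ a b) ?ab// subrr.
move=> x; rewrite /= !in_itv/= => /andP[ax xb].
by rewrite (le_trans a0 (ltW ax)) (le_trans xb).
Qed.

Lemma uniform_prob01_ray (R : realType) (c : R) : 0 <= c -> c <= 1 ->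
  uniform_prob (@ltr01 R) `]-oo, c]%classic = c%:E.
Proof.
move=> c0 c1.
rewrite uniform_prob01E// (_ : _ `&` _ = `[0, c]%classic); last first.
  apply/seteqP; split=> y /=; rewrite !in_itv/=; first by move=> [-> /andP[->]].
  by move=> /andP[-> yc]; rewrite yc (le_trans yc).
rewrite lebesgue_measure_itv/= lte_fin; case: ltP => [_|c0'].
  by rewrite oppr0 adde0.
by congr EFin; apply: le_anti; rewrite c0.
Qed.

(** This is F(Z), the rank of Z within its own law. *)
Definition cdf_transform (d : measure_display) (T : measurableType d)
    (R : realType) (P : probability T R) (Z : {RV P >-> R}) : T -> R :=
  fun w => fine (cdf Z (Z w)).

Lemma measurable_cdf_transform (d : measure_display) (T : measurableType d)
    (R : realType) (P : probability T R) (Z : {RV P >-> R}) :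
  measurable_fun [set: T] (cdf_transform Z).
Proof.
apply: (@measurableT_comp _ _ _ _ _ _ (fun x => fine (cdf Z x)) _ Z) => //.
apply: nondecreasing_measurable => //= x y; exact: fine_cdf_nondecreasing.
Qed.

HB.instance Definition _ (d : measure_display) (T : measurableType d)
    (R : realType) (P : probability T R) (Z : {RV P >-> R}) :=
  isMeasurableFun.Build _ _ _ _ (cdf_transform Z) (measurable_cdf_transform Z).

Lemma cdf_transform_ge0 (d : measure_display) (T : measurableType d)
    (R : realType) (P : probability T R) (Z : {RV P >-> R}) (w : T) :
  0 <= cdf_transform Z w.
Proof. by rewrite /cdf_transform fine_ge0// cdf_ge0. Qed.

Lemma cdf_transform_le1 (d : measure_display) (T : measurableType d)
    (R : realType) (P : probability T R) (Z : {RV P >-> R}) (w : T) :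
  cdf_transform Z w <= 1.
Proof.
by rewrite /cdf_transform -lee_fin fineK ?fin_num_measure// cdf_le1.
Qed.

(** The identity has two Borel structures on its sides: the generated
    sigma-algebra that carries [uniform_prob], and the canonical one of R that
    random variables use. *)
Definition borel_id (R : realType) : measurableTypeR R -> R := idfun.

HB.instance Definition _ (R : realType) :=
  isMeasurableFun.Build _ _ _ _ (@borel_id R) (@measurable_id _ _ setT).

(** The probability integral transform.  For 0 < c < 1 the event F(Z) <= c is
    Z <= x for the largest c-quantile x, which has probability F x = c. *)
Lemma cdf_transform_uniform (d : measure_display) (T : measurableType d)
    (R : realType) (P : probability T R) (Z : {RV P >-> R}) :
  (forall c, P (Z @^-1` [set c]) = 0%E) ->
  forall A, measurable A ->
    P [set w | A (cdf_transform Z w)] = uniform_prob (@ltr01 R) A.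
Proof.
move=> hZ A mA.
have inner c : 0 < c -> c < 1 -> P [set w | cdf_transform Z w <= c] = c%:E.
  move=> c0 c1; have [x <- hx] := atomless_quantile hZ c0 c1.
  rewrite fineK ?fin_num_measure//; congr (P _).
  by apply/seteqP; split=> w /=; rewrite in_itv/= hx.
suff cdfE c : cdf (cdf_transform Z : {RV P >-> R}) c =
    cdf (@borel_id R : {RV uniform_prob (@ltr01 R) >-> R}) c.
  by have := eq_law_of_eq_cdf cdfE mA.
rewrite /cdf /distribution/= /pushforward/=.
rewrite (_ : _ @^-1` _ = [set w | cdf_transform Z w <= c]); last first.
  by apply/seteqP; split=> w /=; rewrite in_itv/=.
rewrite (_ : @borel_id R @^-1` _ = `]-oo, c]%classic)//.
have [c0|c0] := ltP c 0.
  rewrite uniform_prob01E// (_ : [set w | cdf_transform Z w <= c] = set0); last first.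
    rewrite -subset0 => w /= /le_lt_trans/(_ c0).
    by rewrite ltNge cdf_transform_ge0.
  rewrite measure0 [X in lebesgue_measure X](_ : _ = set0) ?measure0//.
  rewrite -subset0 => y [] /=; rewrite !in_itv/= => yc /andP[y0 _].
  by have := le_lt_trans (le_trans y0 yc) c0; rewrite ltxx.
have [c1|c1] := leP 1 c.
  rewrite (_ : [set w | cdf_transform Z w <= c] = setT); last first.
    by apply/seteqP; split=> // w _ /=; rewrite (le_trans (cdf_transform_le1 _ _)).
  rewrite probability_setT uniform_prob01E// setIidr; last first.
    by move=> y /=; rewrite !in_itv/= => /andP[_ /le_trans]; apply.
  by rewrite lebesgue_measure_itv/= lte_fin ltr01 oppr0 adde0.
rewrite uniform_prob01_ray// ?(ltW c1)//.
move: c0; rewrite le_eqVlt => /orP[/eqP <-|/inner]; last exact.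
(* At c = 0 a quantile may fail to exist: let c > 0 tend to 0 instead. *)
apply/eqP; rewrite eq_le measure_ge0 andbT.
apply/lee_addgt0Pr => e e0; rewrite add0e.
pose f := Num.min e 2^-1.
have f0 : 0 < f by rewrite lt_min e0 invr_gt0 ltr0n.
have f1 : f < 1 by rewrite gt_min invf_lt1 ?ltr1n ?ltr0n ?orbT.
apply: (@le_trans _ _ f%:E); last by rewrite lee_fin ge_min lexx.
rewrite -inner//; apply: le_measure; rewrite ?inE//.
- exact: measurable_sublevel (measurable_cdf_transform Z).
- exact: measurable_sublevel (measurable_cdf_transform Z).
- by move=> w /= /le_trans; apply; exact: ltW.
Qed.

(** * Joint distribution functions of ranks are copulas *)

Lemma fine_probability_union_bound (d : measure_display) (T : measurableType d)
    (R : realType) (P : probability T R) (I : finType) (A : I -> set T)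
    (B C : set T) :
  measurable B -> measurable C -> (forall i, measurable (A i)) ->
  (forall w, C w -> B w \/ exists i, A i w) ->
  fine (P C) <= fine (P B) + \sum_i fine (P (A i)).
Proof.
move=> mB mC mA CBA.
pose U (s : seq I) := \big[setU/set0]_(i <- s) A i.
have mU s : measurable (U s) by apply: bigsetU_measurable.
have PU s : fine (P (U s)) <= \sum_(i <- s) fine (P (A i)).
  rewrite /U; elim: s => [|i s IHs]; first by rewrite !big_nil measure0.
  rewrite !big_cons; apply: le_trans (lerD (lexx _) IHs).
  rewrite -lee_fin EFinD !fineK ?fin_num_measure//; last first.
  - by apply: measurableU => //; exact: mU.
  - exact: mU.
  - by apply: measureU2 => //; exact: mU.
apply: le_trans (lerD (lexx _) (PU _)).
rewrite -lee_fin EFinD !fineK ?fin_num_measure//.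
apply: le_trans (measureU2 _ mB (mU _)).
apply: le_measure; rewrite ?inE//; first exact: measurableU.
move=> w /CBA[Bw|[i Aiw]]; [by left|right].
by rewrite /U -bigcup_seq; exists i => //=; rewrite mem_index_enum.
Qed.

Lemma probability_exists_null (d : measure_display) (T : measurableType d)
    (R : realType) (P : probability T R) (I : finType) (A : I -> set T) :
  (forall i, measurable (A i)) -> (forall i, P (A i) = 0%E) ->
  measurable [set w | exists i, A i w] /\ P [set w | exists i, A i w] = 0%E.
Proof.
move=> mA A0; have mE : measurable [set w | exists i, A i w].
  rewrite (_ : [set w | _] = ~` [set w | forall i, (~` A i) w]); last first.
    apply/seteqP; split=> w /=; first by move=> [i Aw] /(_ i).
    by move=> /existsNP[i /contrapT Aw]; exists i.
  by apply: measurableC; apply: measurable_forall => i; exact: measurableC.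
split=> //; apply/eqP; rewrite -measure_le0 -[leLHS]fineK ?fin_num_measure//.
rewrite lee_fin.
have := fine_probability_union_bound P measurable0 mE mA (fun w Ew => or_intror Ew).
by rewrite measure0 add0r big1// => i _; rewrite A0.
Qed.

Lemma cdf_transform_atomless (d : measure_display) (T : measurableType d)
    (R : realType) (P : probability T R) (Z : {RV P >-> R}) :
  (forall c, P (Z @^-1` [set c]) = 0%E) ->
  forall c, P [set w | cdf_transform Z w = c] = 0%E.
Proof.
move=> hZ c; have mc : measurable ([set c] : set R) by exact: measurable_set1.
rewrite (cdf_transform_uniform hZ mc) uniform_prob01E//.
apply: subset_measure0 (lebesgue_measure_set1 c) => //.
exact: measurableI.
Qed.

(** The two boxes differ only where some coordinate V_i falls between v_i and
    u_i, which for a uniform V_i has probability at most |u_i - v_i|. *)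
Lemma uniform_vector_lipschitz (d : measure_display) (T : measurableType d)
    (R : realType) (P : probability T R) (p : nat) (V : 'I_p -> T -> R)
    (mV : forall i, measurable_fun [set: T] (V i))
    (hV : forall i (A : set R), measurable A ->
       P [set w | A (V i w)] = uniform_prob (@ltr01 R) A)
    (u v : 'I_p -> R) :
  (forall i, u i \in `[0, 1]) -> (forall i, v i \in `[0, 1]) ->
  fine (P [set w | forall i, V i w <= u i]) <=
  fine (P [set w | forall i, V i w <= v i]) + \sum_i `|u i - v i|.
Proof.
move=> hu hv.
have mE (x : 'I_p -> R) : measurable [set w | forall i, V i w <= x i].
  by apply: measurable_forall => i; exact: measurable_sublevel.
have mA (i : 'I_p) : measurable (V i @^-1` `]v i, u i]).
  by rewrite -[X in measurable X]setTI; exact: mV.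
have hbound := fine_probability_union_bound P (mE v) (mE u) mA.
apply: (le_trans (hbound _)).
  move=> w Vu; have [Vv|/existsNP[i Vi]] := pselect (forall i, V i w <= v i).
    by left.
  by right; exists i; rewrite /= in_itv/= (Vu i) andbT ltNge; exact/negP.
rewrite lerD2l; apply: ler_sum => i _.
rewrite hV//; have [uv|uv] := leP (v i) (u i); last first.
  rewrite set_itv_ge; last by rewrite bnd_simp -leNgt ltW.
  by rewrite measure0 normr_ge0.
move: (hu i) (hv i); rewrite !in_itv/= => /andP[_ u1] /andP[v0 _].
by rewrite uniform_prob01_itv//= ler_norm.
Qed.

(** The levels 0 and 1 need not be values of F, so a level of [0,1] is first
    moved inside ]0,1[ by at most e, and a quantile is taken there. *)
Lemma cdf_transform_approx (d : measure_display) (T : measurableType d)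
    (R : realType) (P : probability T R) (Z : {RV P >-> R})
    (hZ : forall c, P (Z @^-1` [set c]) = 0%E) (u e : R) :
  u \in `[0, 1] -> 0 < e ->
  exists x, [/\ fine (cdf Z x) \in `[0, 1], `|u - fine (cdf Z x)| <= e &
    forall w, (cdf_transform Z w <= fine (cdf Z x)) = (Z w <= x)].
Proof.
rewrite in_itv/= => /andP[u0 u1] e0.
have [c [c0 c1 ce]] : exists c, [/\ 0 < c, c < 1 & `|u - c| <= e].
  have [ue|ue] := lerP u (1 / 2).
    exists (u + Num.min e (1 / 4)).
    have m0 : 0 < Num.min e (1 / 4) by rewrite lt_min e0; lra.
    have m1 : Num.min e (1 / 4) <= 1 / 4 by rewrite ge_min lexx orbT.
    have me : Num.min e (1 / 4) <= e by rewrite ge_min lexx.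
    split; [lra|lra|].
    by rewrite opprD addNKr normrN gtr0_norm.
  exists (u - Num.min e (1 / 4)).
  have m0 : 0 < Num.min e (1 / 4) by rewrite lt_min e0; lra.
  have m1 : Num.min e (1 / 4) <= 1 / 4 by rewrite ge_min lexx orbT.
  have me : Num.min e (1 / 4) <= e by rewrite ge_min lexx.
  split; [lra|lra|].
  by rewrite opprB addrC subrK gtr0_norm.
have [x xc hx] := atomless_quantile hZ c0 c1.
exists x; rewrite xc in_itv/= (ltW c0) (ltW c1); split => // w.
by rewrite /cdf_transform hx.
Qed.

Section copula_value.
Context (d : measure_display) (T : measurableType d) (R : realType)
  (P : probability T R) (p : nat) (Z : 'I_p -> {RV P >-> R}).
Context (hZ : forall i c, P (Z i @^-1` [set c]) = 0%E).

Definition cdf_vector (w : T) : p.-tuple (measurableTypeR R) :=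
  [tuple cdf_transform (Z i) w | i < p].

Lemma measurable_cdf_vector : measurable_fun [set: T] cdf_vector.
Proof.
apply/measurable_fun_tnthP => i.
rewrite (_ : _ \o _ = cdf_transform (Z i)); first exact: measurable_cdf_transform.
by apply/funext => w; rewrite /= tnth_mktuple.
Qed.

HB.instance Definition _ := isMeasurableFun.Build _ _ _ _ cdf_vector
  measurable_cdf_vector.

(** The joint distribution function of the ranks, which is the copula of Z when
    no Z_i has an atom. *)
Definition rank_copula (u : 'I_p -> R) : R :=
  fine (P [set w | forall i, cdf_transform (Z i) w <= u i]).

Lemma measurable_rank_box (u : 'I_p -> R) :
  measurable [set w | forall i, cdf_transform (Z i) w <= u i].
Proof.
apply: measurable_forall => i.
exact: measurable_sublevel (measurable_cdf_transform _).
Qed.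

(** The witnessing law is that of the vector of ranks.  In Sklar's relation the
    events Z_i <= x_i and F_i(Z_i) <= F_i(x_i) differ only where F_i is flat
    to the right of x_i; there F_i(Z_i) takes the single value F_i(x_i), which
    has probability 0. *)
Lemma rank_copula_is_copula_of : is_copula_of Z rank_copula.
Proof.
split.
  exists (distribution P cdf_vector); split=> [i A mA|u _].
    rewrite /distribution/= /pushforward/=.
    rewrite -(cdf_transform_uniform (hZ i) mA); congr (P _).
    by apply/seteqP; split=> w /=; rewrite tnth_mktuple.
  rewrite /rank_copula fineK ?fin_num_measure//; last exact: measurable_rank_box.
  rewrite /distribution/= /pushforward/=; congr (P _).
  by apply/seteqP; split=> w /= h i; have := h i; rewrite tnth_mktuple.
move=> x; rewrite /rank_copula fineK ?fin_num_measure//; last exact: measurable_rank_box.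
have mE1 : measurable [set w | forall i, Z i w <= x i].
  by apply: measurable_forall => i; exact: measurable_sublevel.
pose v i := fine (cdf (Z i) (x i)).
have mE2 := measurable_rank_box v.
have [mN N0] := probability_exists_null
  (fun i => measurable_funPTI (cdf_transform (Z i)) (measurable_set1 (v i)))
  (fun i => cdf_transform_atomless (hZ i) (v i)).
apply: (probability_eq_off_null mE1 mE2 mN N0) => w /= /forallNP nN.
split=> h i; first exact: fine_cdf_nondecreasing.
rewrite leNgt; apply/negP => xZ; apply: (nN i); apply: le_anti.
by rewrite /v {1}/cdf_transform h fine_cdf_nondecreasing// ltW.
Qed.

(** Sklar's relation fixes a copula at the vectors F(x), where it agrees with
    [rank_copula].  These vectors come arbitrarily close to every point of the
    cube, and distribution functions of uniform vectors are Lipschitz, so the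
    agreement extends to the whole cube, faces included. *)
Lemma copula_ofE (u : 'I_p -> R) : (forall i, u i \in `[0, 1]) ->
  copula_of Z u = rank_copula u.
Proof.
move=> hu; have : is_copula_of Z (copula_of Z).
  by rewrite /copula_of; case: xgetP => [C -> //|/(_ rank_copula)/(_ rank_copula_is_copula_of)].
move: (copula_of Z) => C [[Q [Qunif QC]] PC].
have close e : 0 < e -> exists v : 'I_p -> R, [/\ forall i, v i \in `[0, 1],
    \sum_i `|u i - v i| <= e & C v = rank_copula v].
  move=> e0; pose e' := e / p.+1%:R.
  have e'0 : 0 < e' by rewrite divr_gt0.
  have /choice[x hx] i := cdf_transform_approx (hZ i) (hu i) e'0.
  exists (fun i => fine (cdf (Z i) (x i))); split=> [i||]; first by case: (hx i).
    apply: (@le_trans _ _ (\sum_(i < p) e')); first by apply: ler_sum => i _; case: (hx i).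
    rewrite sumr_const card_ord -mulr_natr /e' -mulrA ler_piMr ?ltW//.
    by rewrite mulrC ltr_pdivrMr// mul1r ltr_nat.
  rewrite /rank_copula; have := PC x => /(congr1 fine)/= <-; congr (fine (P _)).
  apply/seteqP; split=> w /= h i; have := h i; by case: (hx i) => _ _ ->.
have CE v : (forall i, v i \in `[0, 1]) ->
    C v = fine (Q [set z | forall i, tnth z i <= v i]) by move=> /QC ->.
have Qlip := uniform_vector_lipschitz (P := Q) (V := fun i z => tnth z i)
  (fun i => @measurable_tnth _ _ p i) Qunif.
have Plip := uniform_vector_lipschitz (P := P)
  (fun i => measurable_cdf_transform (Z i))
  (fun i A mA => cdf_transform_uniform (hZ i) mA).
apply/eqP; rewrite eq_le; apply/andP; split; apply/ler_addgt0Pr => e e0.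
- have [v [hv uv Cv]] := close _ (divr_gt0 e0 (ltr0n R 2)).
  have := Qlip _ _ hu hv; have := Plip _ _ hv hu; under eq_bigr do rewrite distrC.
  by rewrite -!CE// -!/(rank_copula _) -Cv => h1 h2; lra.
- have [v [hv uv Cv]] := close _ (divr_gt0 e0 (ltr0n R 2)).
  have := Qlip _ _ hv hu; have := Plip _ _ hu hv.
  have -> : \sum_i `|v i - u i| = \sum_i `|u i - v i|.
    by apply: eq_bigr => i _; rewrite distrC.
  by rewrite -!CE// -!/(rank_copula _) -Cv => h1 h2; lra.
Qed.

End copula_value.

(** * Inclusion-exclusion over increasing families of indices *)

Lemma sum_subsetU1 (R : zmodType) (I : finType) (i : I) (D : {set I})
    (F : {set I} -> R) : i \notin D ->
  \sum_(J : {set I} | J \subset i |: D) F J =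
  \sum_(J : {set I} | J \subset D) F J +
  \sum_(J : {set I} | J \subset D) F (i |: J).
Proof.
move=> iD; rewrite (bigID (fun J : {set I} => i \in J)) [LHS]addrC/=; congr (_ + _).
  apply: eq_bigl => J; apply/andP/idP => [[/fintype.subsetP JD iJ]|JD].
    apply/fintype.subsetP => j jJ; move: (JD _ jJ); rewrite !inE => /orP[/eqP ji|//].
    by rewrite -ji jJ in iJ.
  split; first exact: fintype.subset_trans JD (finset.subsetUr _ _).
  by apply: contraNN iD; exact: (fintype.subsetP JD).
rewrite (reindex_onto (fun J : {set I} => i |: J) (fun J => J :\ i))/=; last first.
  by move=> J /andP[_ iJ]; rewrite finset.setD1K.
apply: eq_bigl => J; rewrite finset.setU11 andbT; apply/andP/idP => [[JD /eqP Ji]|JD].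
  apply/fintype.subsetP => j jJ; move/fintype.subsetP: JD => /(_ j); rewrite !inE jJ orbT => /(_ isT).
  by case/orP => // /eqP ji; move: jJ; rewrite -Ji ji !inE eqxx.
have iJ : i \notin J by apply: contraNN iD; exact: (fintype.subsetP JD).
by rewrite finset.setUS//= finset.setU1K.
Qed.

(** By induction on D one expands P(B and no A_i for i in D), for all events B
    at once: removing i from D replaces it by P(B and no A_j) minus
    P(B and A_i and no A_j), j ranging over the rest of D. *)
Lemma inclusion_exclusion (d : measure_display) (T : measurableType d)
    (R : realType) (P : probability T R) (I : finType) (A : I -> set T)
    (mA : forall i, measurable (A i)) :
  fine (P [set w | forall i, ~ A i w]) =
  \sum_(J : {set I}) (-1) ^+ #|J| * fine (P [set w | forall i, i \in J -> A i w]).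
Proof.
pose M (J : {set I}) := [set w | forall i, i \in J -> A i w].
pose O (J : {set I}) := [set w | forall i, i \in J -> ~ A i w].
have mM J : measurable (M J).
  apply: (measurable_forall (A := fun i => [set w | i \in J -> A i w])) => i.
  case: (i \in J).
    rewrite (_ : [set w | _] = A i)//; apply/seteqP; split=> w/=; [exact|by []].
  by rewrite (_ : [set w | _] = setT)//; apply/seteqP; split=> w/=.
have mO J : measurable (O J).
  apply: (measurable_forall (A := fun i => [set w | i \in J -> ~ A i w])) => i.
  case: (i \in J).
    rewrite (_ : [set w | _] = ~` A i); first exact: measurableC.
    by apply/seteqP; split=> w/=; [exact|move=> ? _].
  by rewrite (_ : [set w | _] = setT)//; apply/seteqP; split=> w/=.
(* B collects the events A_i of the indices already removed from D. *)
suff gen (D : {set I}) : forall B, measurable B ->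
    fine (P (B `&` O D)) =
    \sum_(J : {set I} | J \subset D) (-1) ^+ #|J| * fine (P (B `&` M J)).
  have := gen [set: I]%SET _ measurableT; rewrite setTI.
  rewrite (_ : O _ = [set w | forall i, ~ A i w]); last first.
    by apply/seteqP; split=> w h i; [apply: h; rewrite inE|move=> _; exact: h].
  by move=> ->; apply: eq_big => J; rewrite ?finset.subsetT ?setTI.
have [m] := ubnP #|D|; elim: m D => // m IHm D Dm B mB.
have [->|[i iD]] := set_0Vmem D.
  rewrite (big_pred1 finset.set0) => [|J]; last by rewrite finset.subset0.
  rewrite cards0 expr0 mul1r; congr (fine (P (_ `&` _))).
  by apply/seteqP; split=> w _ i; rewrite inE.
have cD : (#|D :\ i| < m)%N by move: Dm; rewrite (cardsD1 i D) iD.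
have iD' : i \notin D :\ i by rewrite !inE eqxx.
rewrite -(finset.setD1K iD) sum_subsetU1//.
have -> : \sum_(J : {set I} | J \subset D :\ i)
     (-1) ^+ #|i |: J| * fine (P (B `&` M (i |: J))) =
    - fine (P ((B `&` A i) `&` O (D :\ i))).
  rewrite IHm//; last exact: measurableI.
  rewrite -sumrN; apply: eq_bigr => J JD.
  have iJ : i \notin J by apply: contraNN iD'; exact: (fintype.subsetP JD).
  rewrite cardsU1 iJ exprS mulN1r mulNr -setIA; congr (- (_ * fine (P (_ `&` _)))).
  apply/seteqP; split=> w/=.
    by move=> h; split; [|move=> j jJ]; apply: h; rewrite !inE ?eqxx// jJ orbT.
  by move=> [Ai h] j; rewrite !inE => /orP[/eqP ->//|/h].
rewrite -IHm//; apply/eqP; rewrite -subr_eq opprK; apply/eqP.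
rewrite [in RHS](_ : B `&` O (D :\ i) =
   (B `&` O (i |: (D :\ i))) `|` (B `&` A i `&` O (D :\ i))); last first.
  apply/seteqP; split=> w/=.
    move=> [Bw Ow]; have [Ai|Ai] := pselect (A i w); [by right|left; split=> //].
    by move=> j; rewrite in_setU1 => /orP[/eqP ->//|/Ow].
  move=> [[Bw Ow]|[[Bw _]]//]; split=> // j jD; apply: Ow.
  by rewrite in_setU1 jD orbT.
rewrite measureU ?fineD ?fin_num_measure//.
all: try by do ?apply: measurableI.
apply/seteqP; split=> // w [[_ Ow] [[_ Ai] _]].
by apply: (Ow i) Ai; rewrite finset.setU11.
Qed.

Lemma increasing_idx_sorted (r m : nat) (k : {ffun 'I_r -> 'I_m}) :
  increasing_idx k -> sorted ltn [seq val (k i) | i <- enum 'I_r].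
Proof.
move=> /forallP kI; have : sorted ltn (map val (enum 'I_r)).
  by rewrite val_enum_ord iota_ltn_sorted.
rewrite !sorted_map; apply: sub_sorted => i j /= ij.
by move: (kI i) => /forallP/(_ j)/implyP; apply.
Qed.

(** An increasing family is the sorted enumeration of its range. *)
Lemma increasing_idx_inj (r m : nat) :
  {in [pred k : {ffun 'I_r -> 'I_m} | increasing_idx k] &,
    injective (fun k : {ffun 'I_r -> 'I_m} => [set k i | i in 'I_r]%SET)}.
Proof.
move=> k1 k2; rewrite !inE => /increasing_idx_sorted s1 /increasing_idx_sorted s2 k12.
have eqk : [seq val (k1 i) | i <- enum 'I_r] = [seq val (k2 i) | i <- enum 'I_r].
  apply: (irr_sorted_eq ltn_trans ltnn s1 s2) => x.
  apply/mapP/mapP => -[i _ ->].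
    have : k1 i \in [set k2 i | i in 'I_r]%SET by rewrite -k12 imset_f.
    by case/imsetP => j _ ->; exists j; rewrite ?mem_enum.
  have : k2 i \in [set k1 i | i in 'I_r]%SET by rewrite k12 imset_f.
  by case/imsetP => j _ ->; exists j; rewrite ?mem_enum.
apply/ffunP => i; apply: val_inj.
by move/eq_in_map: eqk; apply; rewrite mem_enum.
Qed.

Lemma card_increasing_idx (r m : nat) (k : {ffun 'I_r -> 'I_m}) :
  increasing_idx k -> #|[set k i | i in 'I_r]%SET| = r.
Proof.
move=> /forallP kI; rewrite card_imset ?card_ord// => i j kij.
have kI' (a b : 'I_r) : (a < b)%N -> (k a < k b)%N.
  by move: (kI a) => /forallP/(_ b)/implyP.
apply: val_inj; case: (ltngtP i j) => // /kI'; by rewrite kij ltnn.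
Qed.

Lemma increasing_enumeration (r m : nat) (J : {set 'I_m}) : #|J| = r ->
  exists2 k : {ffun 'I_r -> 'I_m}, increasing_idx k & J = [set k i | i in 'I_r]%SET.
Proof.
move=> Jr; subst r.
have sJ : sorted ltn (map val (enum J)).
  have tr : transitive (relpre val ltn : rel 'I_m).
    by move=> y x z; exact: ltn_trans.
  rewrite sorted_map (_ : enum J = [seq x <- enum 'I_m | x \in J]).
    by rewrite (sorted_filter tr)// -sorted_map val_enum_ord iota_ltn_sorted.
  by rewrite enumT {1}/enum_mem.
exists [ffun i : 'I_#|J| => enum_val i].
  apply/forallP => i; apply/forallP => j; apply/implyP => ij; rewrite !ffunE.
  have x0 : 'I_m := enum_val i.
  rewrite !(enum_val_nth x0) -!(nth_map x0 0%N val) -?cardE//.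
  by rewrite (sorted_ltn_nth ltn_trans) // inE size_map -cardE.
apply/setP => x; apply/idP/imsetP => [xJ|[i _ ->]]; last by rewrite ffunE enum_valP.
by exists (enum_rank_in xJ x); rewrite // ffunE enum_rankK_in.
Qed.

Lemma sum_sets_increasing (R : pzRingType) (m : nat) (F : {set 'I_m} -> R) :
  \sum_(J : {set 'I_m}) F J =
  \sum_(0 <= r < m.+1) \sum_(k : {ffun 'I_r -> 'I_m} | increasing_idx k)
     F [set k i | i in 'I_r]%SET.
Proof.
rewrite (partition_big (fun J : {set 'I_m} => inord #|J| : 'I_m.+1) xpredT)//=.
rewrite big_mkord; apply: eq_bigr => r _.
rewrite -(big_imset F (@increasing_idx_inj r m)); apply: eq_bigl => J.
have Jm : (#|J| < m.+1)%N by rewrite ltnS (leq_trans (max_card _)) ?card_ord.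
apply/eqP/imsetP => [/(congr1 val)/=|[k]].
  by rewrite inordK// => /increasing_enumeration[k kI ->]; exists k.
by rewrite inE => kI Jk; apply: val_inj; rewrite /= inordK// Jk card_increasing_idx.
Qed.

(** * Manneville-Pomeau processes *)

Section manneville_pomeau.
Context (R : realType) (s : R).

Lemma MP_map_itv (x : R) : 0 < s -> x \in `[0, 1] -> MP_map s x \in `[0, 1].
Proof.
move=> s0; rewrite !in_itv/= => /andP[x0 x1].
have p0 : 0 <= x `^ (1 + s) by exact: powR_ge0.
have p1 : x `^ (1 + s) <= 1.
  have := @ge0_ler_powR R (1 + s) _ x 1; rewrite powR1; apply; rewrite ?nnegrE//.
  by rewrite addr_ge0// ltW.
rewrite /MP_map; case: ltP => y1; apply/andP; split; lra.
Qed.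

Lemma measurable_MP_map : measurable_fun [set: R] (MP_map s).
Proof.
have my : measurable_fun [set: R] (fun x : R => x + x `^ (1 + s)).
  by apply: measurable_funD => //; exact: measurable_powR.
apply: measurable_fun_ifT => //=.
- exact: measurable_fun_ltr.
- exact: measurable_funB.
Qed.

Lemma measurable_iter_MP_map (n : nat) : measurable_fun [set: R] (iter n (MP_map s)).
Proof.
elim: n => [|n IHn]; first exact: measurable_id.
exact: (measurableT_comp measurable_MP_map IHn).
Qed.

Lemma iter_MP_map_itv (n : nat) (x : R) : 0 < s -> x \in `[0, 1] ->
  iter n (MP_map s) x \in `[0, 1].
Proof. by move=> s0 x01; elim: n => //= n IHn; exact: MP_map_itv. Qed.

End manneville_pomeau.

Section process.
Context (R : realType) (s : R) (hs0 : 0 < s)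
  (mu : probability (measurableTypeR R) R)
  (d : measure_display) (Omega : measurableType d) (P : probability Omega R)
  (U0 : {RV P >-> R}) (phi : R -> R) (X : nat -> {RV P >-> R})
  (hX : is_MP_process s mu U0 phi X).

(** Absolute continuity of mu, transferred to U0. *)
Lemma MP_process_null (A : set R) : measurable A ->
  lebesgue_measure A = 0%E -> P (U0 @^-1` A) = 0%E.
Proof.
move=> mA A0; case: hX => -[_ _ /null_content_dominatesP ac] _ law _ _.
by have := law A mA; rewrite (ac A mA A0).
Qed.

(** Invariance is known only for subsets of [0,1] and within [0,1]; since U0
    stays in [0,1], which the map preserves, the events may be cut down to
    that interval. *)
Lemma MP_process_stationary (n : nat) (A : set R) : measurable A ->
  P [set w | A (iter n (MP_map s) (U0 w))] = P (U0 @^-1` A).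
Proof.
case: hX => -[_ inv _] U01 law _ _.
have step B : measurable B -> P [set w | B (MP_map s (U0 w))] = P (U0 @^-1` B).
  move=> mB.
  have mI : measurable (`[0, 1]%classic : set R) by exact: measurable_itv.
  have mBI : measurable (B `&` `[0, 1]%classic) by exact: measurableI.
  have mpre : measurable (`[0, 1]%classic `&` MP_map s @^-1` (B `&` `[0, 1]%classic)).
    apply: measurableI => //; rewrite -[X in measurable X]setTI.
    exact: measurable_MP_map.
  have := inv _ mBI (@subIsetr _ _ _).
  rewrite -(law _ mpre) -(law _ mBI) /distribution/= /pushforward/= => e.
  rewrite (_ : U0 @^-1` B = U0 @^-1` (B `&` `[0, 1]%classic)).
    rewrite -e; congr (P _); apply/seteqP; split=> w /=.
      by move=> Bw; split; [exact: U01|split=> //; exact: MP_map_itv].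
    by move=> [_ []].
  by apply/seteqP; split=> w /= => [Bw|[]//]; split=> //; exact: U01.
elim: n A => [//|n IHn] A mA.
have mTA : measurable (MP_map s @^-1` A).
  by rewrite -[X in measurable X]setTI; exact: measurable_MP_map.
exact: etrans (IHn _ mTA) (step _ mA).
Qed.

Lemma MP_process_atomless (n : nat) (c : R) :
  P [set w | iter n (MP_map s) (U0 w) = c] = 0%E.
Proof.
have mc : measurable ([set c] : set R) by exact: measurable_set1.
have := MP_process_stationary n mc; rewrite (MP_process_null mc) => [<-//|].
exact: lebesgue_measure_set1.
Qed.

(** The common distribution function of all T^n(U0). *)
Definition base_cdf (x : R) : R := fine (cdf U0 x).

Lemma measurable_base_cdf : measurable_fun [set: R] base_cdf.
Proof.
by apply: nondecreasing_measurable => //= x y; exact: fine_cdf_nondecreasing.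
Qed.

Lemma cdf_iter_MP_map (Z : {RV P >-> R}) (n : nat) :
  (forall w, Z w = iter n (MP_map s) (U0 w)) -> forall x, fine (cdf Z x) = base_cdf x.
Proof.
move=> hZ x; rewrite /base_cdf; congr fine.
rewrite /cdf/distribution/= /pushforward/=.
have mI : measurable (`]-oo, x]%classic : set R) by exact: measurable_itv.
rewrite -(MP_process_stationary n mI); congr (P _).
by apply/seteqP; split=> w /=; rewrite hZ.
Qed.

Lemma atomless_iter_MP_map (Z : {RV P >-> R}) (n : nat) :
  (forall w, Z w = iter n (MP_map s) (U0 w)) -> forall c, P (Z @^-1` [set c]) = 0%E.
Proof.
move=> hZ c; rewrite -(MP_process_atomless n c); congr (P _).
by apply/seteqP; split=> w /=; rewrite hZ.
Qed.

(** Since phi is known to be measurable only on [0,1], the sublevel set of phi is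
    intersected with that interval before stationarity applies. *)
Lemma MP_process_sublevel (j : nat) (c : R) :
  P [set w | X j w <= c] = P [set w | phi (U0 w) <= c].
Proof.
case: hX => _ U01 _ intphi XE.
pose B : set R := `[0, 1]%classic `&` phi @^-1` `]-oo, c]%classic.
have mB : measurable B.
  have /measurable_EFinP mphi := measurable_int _ intphi.
  apply: mphi; exact: measurable_itv.
transitivity (P [set w | B (iter j (MP_map s) (U0 w))]).
  congr (P _); apply/seteqP; split=> w /=; rewrite XE /B/= !in_itv/=.
    move=> h; split=> //; have := iter_MP_map_itv j hs0 (U01 w).
    by rewrite in_itv.
  by case.
rewrite MP_process_stationary//; congr (P _); apply/seteqP.
split=> w /=; rewrite /B/= !in_itv/=; first by case.
by move=> h; split=> //; have := U01 w; rewrite in_itv.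
Qed.

Context (N : set R) (mN : measurable N) (N0 : lebesgue_measure N = 0%E)
  (phi_decr : {in `[0, 1]%classic `\` N &, forall x y, x < y -> phi y < phi x}).

(** Off the null set where U0 is in N or equals v, phi(U0) <= phi(v) is the
    same as U0 > v. *)
Lemma cdf_decreasing_MP_process (j : nat) (v : R) : v \in `[0, 1] -> ~ N v ->
  fine (cdf (X j) (phi v)) = 1 - base_cdf v.
Proof.
move=> v01 Nv; case: (hX) => _ U01 _ _ XE.
have Nv0 : P (U0 @^-1` (N `|` [set v])) = 0%E.
  apply: MP_process_null; first exact: measurableU.
  exact: (@null_set_setU _ _ _ (@lebesgue_measure R) N [set v] mN
    (measurable_set1 v) N0 (lebesgue_measure_set1 v)).
have mU : measurable [set w | U0 w <= v] by exact: measurable_sublevel.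
have -> : 1 - base_cdf v = fine (P (~` [set w | U0 w <= v])).
  by rewrite probability_setC// fineB ?fin_num_measure// /base_cdf cdfE.
congr fine.
rewrite cdfE MP_process_sublevel -[LHS](MP_process_sublevel 0).
apply: (probability_eq_off_null _ _ _ Nv0).
- exact: measurable_sublevel.
- exact: measurableC.
- exact: measurable_funPTI (measurableU _ _ mN (measurable_set1 v)).
move=> w /= /not_orP[Nw Uv]; rewrite XE/=.
have inS x : x \in `[0, 1] -> ~ N x -> x \in `[0, 1]%classic `\` N.
  by move=> x01 Nx; rewrite inE.
have [Sw Sv] := (inS _ (U01 w) Nw, inS _ v01 Nv).
case: (ltgtP (U0 w) v) => [lt|gt|//].
  by rewrite leNgt (phi_decr Sw Sv lt); split=> [//|/(_ isT)].
by split=> // _; rewrite ltW// phi_decr.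
Qed.

(** Outside N, phi is injective, so a level set of phi has at most one point
    there. *)
Lemma atomless_decreasing_MP_process (j : nat) (c : R) :
  P (X j @^-1` [set c]) = 0%E.
Proof.
case: (hX) => _ U01 _ _ XE.
have mXc : measurable (X j @^-1` [set c]) by exact: measurable_funPTI.
have [v Nv] : exists v, forall x, x \in `[0, 1] -> phi x = c -> N x \/ x = v.
  have [[v [v01 Nv vc]]|nov] :=
    pselect (exists v, [/\ v \in `[0, 1], ~ N v & phi v = c]).
    exists v => x x01 xc; have [|Nx] := pselect (N x); [by left|right].
    have Sx : x \in `[0, 1]%classic `\` N by rewrite inE.
    have Sv : v \in `[0, 1]%classic `\` N by rewrite inE.
    by case: (ltgtP x v) => // [/(phi_decr Sx Sv)|/(phi_decr Sv Sx)];
      rewrite xc vc ltxx.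
  exists 0 => x x01 xc; left; apply: contrapT => Nx.
  by apply: nov; exists x.
have mM : measurable (N `|` [set v]) by exact: measurableU.
have M0 : P [set w | (N `|` [set v]) (iter j (MP_map s) (U0 w))] = 0%E.
  rewrite MP_process_stationary//; apply: MP_process_null => //.
  exact: (@null_set_setU _ _ _ (@lebesgue_measure R) N [set v] mN
    (measurable_set1 v) N0 (lebesgue_measure_set1 v)).
apply: subset_measure0 M0 => //.
  rewrite -[X in measurable X]setTI.
  by apply: (measurableT_comp (measurable_iter_MP_map s j) (measurable_funPT U0)).
move=> w /=; rewrite XE => /Nv; apply; exact: iter_MP_map_itv.
Qed.

(** Off null sets, the rank of X_(t+a_k) is 1 - F(T^(a_k)(T^t U0)), stationarity
    replaces T^t U0 by U0, and 1 - F(Y_k) <= u_k becomes the strict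
    inequality F(Y_k) > 1 - u_k because the rank of Y_k has no atom. *)
Lemma rank_copula_decreasing (m t : nat) (a : 'I_m -> nat)
    (Y : 'I_m -> {RV P >-> R}) (u : 'I_m -> R) :
  (forall k w, Y k w = iter (a k) (MP_map s) (U0 w)) ->
  rank_copula (fun k => X (t + a k)%N) u =
  fine (P [set w | forall k, ~ cdf_transform (Y k) w <= 1 - u k]).
Proof.
move=> YE; case: (hX) => _ U01 _ _ XE.
have miter j : measurable_fun [set: Omega] (fun w => iter j (MP_map s) (U0 w)).
  exact: (measurableT_comp (measurable_iter_MP_map s j) (measurable_funPT U0)).
pose D : set R := [set x | forall k : 'I_m,
  1 - base_cdf (iter (a k) (MP_map s) x) <= u k].
have mD : measurable D.
  apply: (measurable_forall
    (A := fun k => [set x | 1 - base_cdf (iter (a k) (MP_map s) x) <= u k])) => k.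
  apply: measurable_sublevel; apply: measurable_funB => //.
  exact: (measurableT_comp measurable_base_cdf (measurable_iter_MP_map s (a k))).
congr fine; transitivity (P [set w | D (iter t (MP_map s) (U0 w))]).
  have mN' k : measurable [set w | N (iter (t + a k) (MP_map s) (U0 w))].
    by rewrite -[X in measurable X]setTI; exact: miter.
  have N'0 k : P [set w | N (iter (t + a k) (MP_map s) (U0 w))] = 0%E.
    by rewrite MP_process_stationary//; exact: MP_process_null.
  have [mM M0] := probability_exists_null mN' N'0.
  apply: (probability_eq_off_null _ _ mM M0).
  - exact: measurable_rank_box.
  - by rewrite -[X in measurable X]setTI; exact: miter.
  move=> w /= /forallNP nN.
  have tE k : cdf_transform (X (t + a k)) w =
      1 - base_cdf (iter (a k) (MP_map s) (iter t (MP_map s) (U0 w))).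
    rewrite /cdf_transform XE cdf_decreasing_MP_process//.
      by rewrite addnC iterD.
    exact: iter_MP_map_itv.
  by split=> h k; have := h k; rewrite tE.
rewrite MP_process_stationary//.
have tE k w : cdf_transform (Y k) w = base_cdf (iter (a k) (MP_map s) (U0 w)).
  by rewrite /cdf_transform (cdf_iter_MP_map (YE k)) YE.
have [mM M0] := probability_exists_null
  (fun k => measurable_funPTI (cdf_transform (Y k)) (measurable_set1 (1 - u k)))
  (fun k => cdf_transform_atomless (atomless_iter_MP_map (YE k)) (1 - u k)).
apply: (probability_eq_off_null _ _ mM M0).
- exact: measurable_funPTI.
- apply: (measurable_forall
    (A := fun k => ~` [set w | cdf_transform (Y k) w <= 1 - u k])) => k.
  by apply: measurableC; exact: measurable_sublevel (measurable_cdf_transform _).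
move=> w /= /forallNP nM; split=> h k; move: (nM k) (h k); rewrite tE.
  move=> /eqP neq le1; apply/negP; rewrite -ltNge lt_neqAle eq_sym neq/=.
  by rewrite lerBlDr addrC -lerBlDr.
by move=> _ /negP; rewrite -ltNge => /ltW; rewrite lerBlDr addrC -lerBlDr.
Qed.

End process.

Theorem proposition4p1 (R : realType) (s : R) (hs0 : 0 < s) (hs1 : s < 1)
    (mu : probability (measurableTypeR R) R)
    (d : measure_display) (Omega : measurableType d) (P : probability Omega R)
    (U0 : {RV P >-> R}) (phi : R -> R) (X : nat -> {RV P >-> R})
    (hX : is_MP_process s mu U0 phi X)
    (hphi : ae_decreasing phi)
    (t n : nat) (hn : (1 <= n)%N) (h : 'I_n -> nat)
    (h_gt0 : forall i, (0 < h i)%N)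
    (h_incr : forall i j : 'I_n, (i < j)%N -> (h i < h j)%N)
    (Y : 'I_n.+1 -> {RV P >-> R})
    (hY : forall k w, Y k w = iter (lag h k) (MP_map s) (U0 w))
    (u : 'I_n.+1 -> R) (hu : forall i, u i \in `[0, 1]) :
  copula_of (fun k : 'I_n.+1 => X (t + lag h k)%N) u =
    - n%:R + \sum_(i < n.+1) u i
    + \sum_(2 <= r < n.+2) (-1) ^+ r *
        \sum_(k : {ffun 'I_r -> 'I_n.+1} | increasing_idx k)
          copula_of (fun i => Y (k i)) (fun i => 1 - u (k i)).
Proof.
(* N0 may fail to be Borel, unlike the null set N that contains it. *)
have [N0 [N [mN N00 N0N]] decr0] := hphi.
have decr : {in `[0, 1]%classic `\` N &, forall x y, x < y -> phi y < phi x}.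
  move=> x y; rewrite !inE => -[x01 Nx] [y01 Ny]; apply: decr0; rewrite inE.
    by split=> // /N0N.
  by split=> // /N0N.
have hYatom k := atomless_iter_MP_map hs0 hX (hY k).
rewrite copula_ofE//; last first.
  by move=> i c; apply: (atomless_decreasing_MP_process hs0 hX mN N00 decr).
rewrite (rank_copula_decreasing hs0 hX mN N00 decr t u hY).
have mA k : measurable [set w | cdf_transform (Y k) w <= 1 - u k].
  exact: measurable_sublevel (measurable_cdf_transform _).
rewrite (inclusion_exclusion P mA) sum_sets_increasing.
pose G r (k : {ffun 'I_r -> 'I_n.+1}) :=
  rank_copula (fun i => Y (k i)) (fun i => 1 - u (k i)).
rewrite (eq_big_nat _ _ (F2 := fun r => (-1) ^+ r *
    \sum_(k : {ffun 'I_r -> 'I_n.+1} | increasing_idx k) G r k)); last first.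
  move=> r _; rewrite mulr_sumr; apply: eq_bigr => k kI.
  rewrite card_increasing_idx//; congr (_ * fine (P _)).
  apply/seteqP; split=> w /= hw => [i|_ /imsetP[i _ ->]]; last exact: hw.
  by apply: hw; apply: imset_f.
rewrite 2?big_ltn// addrA; congr (_ + _); last first.
  apply: eq_big_nat => r _; congr (_ * _); apply: eq_bigr => k _.
  rewrite copula_ofE// => i; move: (hu (k i)); rewrite !in_itv/= => /andP[u0 u1].
  by rewrite subr_ge0 u1 gerBl.
have sum0 : \sum_(k : {ffun 'I_0 -> 'I_n.+1} | increasing_idx k) G 0%N k = 1.
  rewrite (big_pred1 [ffun=> ord0]) => [|k]; last first.
    rewrite [RHS](_ : _ = true); last by apply/eqP/ffunP; case.
    by apply/forallP; case.
  rewrite /G /rank_copula (_ : [set w | _] = setT) ?probability_setT//.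
  by apply/seteqP; split=> // w _ [].
have sum1 : \sum_(k : {ffun 'I_1 -> 'I_n.+1} | increasing_idx k) G 1%N k =
    \sum_i (1 - u i).
  have kbij : bijective (fun i : 'I_n.+1 => [ffun _ : 'I_1 => i]).
    exists (fun k : {ffun 'I_1 -> 'I_n.+1} => k ord0) => [i|k]; first by rewrite ffunE.
    by apply/ffunP => i; rewrite ffunE (ord1 i).
  rewrite (reindex _ (onW_bij _ kbij))/=; apply: eq_big => [i|i _].
    by apply/forallP => j; apply/forallP => l; rewrite (ord1 j) (ord1 l).
  have mI : measurable (`]-oo, 1 - u i]%classic : set R) by exact: measurable_itv.
  have := cdf_transform_uniform (hYatom i) mI.
  move: (hu i); rewrite in_itv/= => /andP[u0 u1].
  rewrite uniform_prob01_ray ?subr_ge0 ?gerBl// => e.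
  rewrite -[RHS]/(fine (1 - u i)%:E) -e /G /rank_copula; congr (fine (P _)).
  by apply/seteqP; split=> w /= hw => [|l]; [have := hw ord0|move: hw];
    rewrite ffunE ?in_itv.
rewrite sum0 sum1 expr0 mul1r expr1 mulN1r sumrB sumr_const card_ord.
by rewrite -natr1; ring.
Qed.
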